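(* Let $\mathcal{O}$ be an order of an algebraic number field and let $n\ge 2$ be an integer. Then every matrix in $M_n(\mathcal{O})$ is a sum of sixth powers of matrices in $M_n(\mathcal{O})$ if and only if $\gcd(6,\operatorname{disc}\mathcal{O})=1$.
   Context: An order of an algebraic number field $K$ of degree $m$ is a subring of $K$ containing $1$ which is a free $\mathbb{Z}$-module of rank $m$. $\operatorname{disc}\mathcal{O}$ is the discriminant of $\mathcal{O}$. A matrix $M$ is a sum of sixth powers in $M_n(\mathcal{O})$ if $M=\sum_{i=1}^r M_i^6$ for some $r\ge1$ and $M_i\in M_n(\mathcal{O})$. *)

(* Defs.v *)
From mathcomp Require Import all_boot all_order all_algebra all_field.
From mathcomp Require classical_sets.

Set Implicit Arguments.
Unset Strict Implicit.
Unset Printing Implicit Defensive.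

Import Order.TTheory GRing.Theory Num.Theory.
Import passmx.
Local Open Scope ring_scope.

Section Orders.

(* A fieldExtType over rat is finite-dimensional, i.e., a number field, and
   \dim {:K} is its degree. *)
Variable K : fieldExtType rat.
Local Notation m := (\dim {:K}).

Definition Zbasis (O : {pred K}) (b : m.-tuple K) : Prop :=
  (forall x : K, x \in O <-> exists c : 'I_m -> int, x = \sum_(i < m) b`_i *~ c i)
  /\ (forall c : 'I_m -> int, \sum_(i < m) b`_i *~ c i = 0 -> forall i, c i = 0).

Definition is_order (O : {pred K}) : Prop :=
  subring_closed O /\ exists b : m.-tuple K, Zbasis O b.

Definition fieldTrace (x : K) : rat :=
  \tr (mxof (vbasis {:K}) (vbasis {:K}) (amull x)).

Definition basis_disc (b : m.-tuple K) : rat :=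
  \det (\matrix_(i < m, j < m) fieldTrace (b`_i * b`_j)).

(* When O is an order, such an integer exists and does not depend on the
   Z-basis: see order_discE. The default 0 is only used for other sets. *)
Definition order_disc (O : {pred K}) : int :=
  classical_sets.xget 0 (fun d : int =>
    exists b : m.-tuple K, Zbasis O b /\ basis_disc b = d%:~R).

End Orders.

Definition sum_of_sixth_powers (R : pzRingType) (O : {pred R}) (n : nat)
    (M : 'M[R]_n) : Prop :=
  exists r : nat, (1 <= r)%N /\
    exists N : 'I_r -> 'M[R]_n,
      (forall i, N i \is a mxOver O) /\ M = \sum_i N i ^+ 6.

Section OrderDisc.

Variable K : fieldExtType rat.
Local Notation m := (\dim {:K}).

Lemma Zbasis_basis (O : {pred K}) (b : m.-tuple K) :
  Zbasis O b -> basis_of {:K} b.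
Proof.
move=> [_ bfree]; rewrite basisEfree subvf size_tuple leqnn !andbT.
apply/freeP => k k0.
pose D := \prod_i denq (k i).
have D0 : D != 0 by apply/prodf_neq0 => i _; exact: denq_neq0.
have Dk i : k i * D%:~R = (numq (k i) * \prod_(j | j != i) denq (k j))%:~R.
  rewrite /D (bigD1 i) //= !intrM mulrA; congr (_ * _).
  by rewrite -{1}[k i]divq_num_den divfK // intr_eq0 denq_neq0.
have /bfree c0 : \sum_(i < m) b`_i *~ (numq (k i) * \prod_(j | j != i) denq (k j)) = 0.
  transitivity ((D%:~R : rat) *: \sum_(i < m) k i *: b`_i); last first.
    by rewrite k0 scaler0.
  rewrite scaler_sumr.
  by apply: eq_bigr => i _; rewrite -scaler_int scalerA [_ * k i]mulrC Dk.
move=> i; have := Dk i; rewrite c0 => /eqP.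
by rewrite mulf_eq0 intr_eq0 (negPf D0) orbF => /eqP.
Qed.

Lemma fieldTraceE (b : m.-tuple K) (x : K) :
  basis_of {:K} b -> fieldTrace x = \tr (mxof b b (amull x)).
Proof.
move=> bB; have vB := vbasisP {:K}.
pose v := vbasis {:K}.
have e1 : (\1 \o (amull x \o \1) = amull x :> 'End(K))%VF.
  by apply/lfunP => u; rewrite !lfunE /= !lfunE /= !lfunE.
have e2 : (\1 \o \1 = \1 :> 'End(K))%VF.
  by apply/lfunP => u; rewrite !lfunE /= !lfunE.
rewrite /fieldTrace -[in LHS]e1 (mxof_comp _ _ bB) (mxof_comp _ _ bB).
rewrite -mulmxA mxtrace_mulC -mulmxA -(mxof_comp _ _ vB).
by rewrite e2 mxof1 ?mulmx1 // (basis_free bB).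
Qed.

Lemma Zbasis_mem (O : {pred K}) (b : m.-tuple K) (i : 'I_m) :
  Zbasis O b -> b`_i \in O.
Proof.
case=> sp _; apply/sp; exists (fun j => (j == i)%:R).
rewrite (bigD1 i) //= eqxx mulr1z big1 ?addr0 // => j /negPf ->.
by rewrite mulr0z.
Qed.

Lemma Zbasis_coord (O : {pred K}) (b : m.-tuple K) (x : K) (i : 'I_m) :
  Zbasis O b -> x \in O -> coord b i x \is a Num.int.
Proof.
move=> Zb; have [sp _] := Zb; move=> /sp[c ->].
have bf := basis_free (Zbasis_basis Zb).
under eq_bigr do rewrite -scaler_int.
by rewrite coord_sum_free // intr_int.
Qed.

Lemma fieldTrace_int (O : {pred K}) (x : K) :
  is_order O -> x \in O -> fieldTrace x \is a Num.int.
Proof.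
move=> [[_ _ OM] [b Zb]] xO; rewrite (fieldTraceE _ (Zbasis_basis Zb)).
apply: rpred_sum => i _; rewrite !mxE vecof_delta lfunE /=.
by apply: Zbasis_coord (Zb) _; apply: OM => //; apply: Zbasis_mem Zb.
Qed.

Lemma basis_disc_int (O : {pred K}) (b : m.-tuple K) :
  is_order O -> Zbasis O b -> basis_disc b \is a Num.int.
Proof.
move=> Oo Zb; apply: rpred_sum => s _; apply: rpredM.
  by rewrite rpredX // rpredN1.
apply: rpred_prod => i _; rewrite mxE; apply: (fieldTrace_int Oo).
by case: Oo => -[_ _ OM] _; apply: OM; apply: Zbasis_mem Zb.
Qed.

Lemma fieldTrace_sum (c : 'I_m -> rat) (x : 'I_m -> K) :
  fieldTrace (\sum_i c i *: x i) = \sum_i c i * fieldTrace (x i).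
Proof.
rewrite /fieldTrace !linear_sum /=; apply: eq_bigr => i _.
by rewrite !linearZ.
Qed.

Lemma basis_disc_change (b b' : m.-tuple K) : basis_of {:K} b ->
  basis_disc b' = \det (\matrix_(i, j) coord b j b'`_i) ^+ 2 * basis_disc b.
Proof.
move=> bB; set P := \matrix_(i, j) _.
rewrite /basis_disc expr2 mulrAC -{2}(det_tr P) -!det_mulmx; congr (\det _).
apply/matrixP => i j; rewrite mxE.
rewrite {1}(coord_basis bB (memvf b'`_i)) {1}(coord_basis bB (memvf b'`_j)).
rewrite mulr_sumr.
under eq_bigr do rewrite -scalerAr.
rewrite fieldTrace_sum mxE; apply: eq_bigr => l _.
rewrite mulr_suml; under eq_bigr do rewrite -scalerAl.
rewrite fieldTrace_sum !mxE mulrC; congr (_ * _).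
by apply: eq_bigr => k _; rewrite !mxE.
Qed.

Lemma order_discE (O : {pred K}) (b : m.-tuple K) :
  is_order O -> Zbasis O b -> (order_disc O)%:~R = basis_disc b.
Proof.
move=> Oo Zb; have /intrP[d db] := basis_disc_int Oo Zb.
have [|b' [Zb' <-]] := @classical_sets.xgetPex _ 0 (fun d : int =>
    exists b : m.-tuple K, Zbasis O b /\ basis_disc b = d%:~R).
  by exists d, b.
have cint (b1 b2 : m.-tuple K) : Zbasis O b1 -> Zbasis O b2 ->
    \det (\matrix_(i, j) coord b1 j b2`_i) \is a Num.int.
  move=> Z1 Z2; apply: rpred_sum => s _; apply: rpredM.
    by rewrite rpredX // rpredN1.
  apply: rpred_prod => i _; rewrite mxE.
  by apply: Zbasis_coord (Z1) _; apply: Zbasis_mem Z2.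
rewrite (basis_disc_change b' (Zbasis_basis Zb)).
have /intrP[p pE] := cint _ _ Zb Zb'; have /intrP[q qE] := cint _ _ Zb' Zb.
have pq : p * q = 1.
  apply/(@intr_inj rat); rewrite intrM -pE -qE -det_mulmx -[RHS](det1 rat m).
  congr (\det _); apply/matrixP => i j; rewrite !mxE.
  have b'B := Zbasis_basis Zb'.
  rewrite -(coord_free _ _ (basis_free b'B)).
  rewrite [in RHS](coord_basis (Zbasis_basis Zb) (memvf b'`_i)).
  by rewrite linear_sum; apply: eq_bigr => k _; rewrite !mxE linearZ.
have : `|p|%N == 1%N.
  have /(congr1 absz) := pq; rewrite abszM => /eqP.
  by rewrite muln_eq1 => /andP[].
move/eqP=> p1; have p2 : p ^+ 2 = 1.
  by rewrite [p]intEsign p1 mulr1 sqrr_sign.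
by rewrite pE -rmorphXn p2 mul1r.
Qed.

End OrderDisc.

(* Main.v *)
(* For p = 2, 3 write "Frobenius" for x |-> x^p on O / pO.

   Sums of sixth powers in M_n(O): idempotents and the matrix J = (0 -1; 1 0),
   whose sixth power is -1, give every trace zero 2x2 matrix, so for n = 2 only
   the trace matters, and the traces obtained form an additive monoid T generated
   by t^6 - 6 t^4 d + 9 t^2 d^2 - 2 d^3. T contains 2 d^3, 12 d and 9 d^2 - 6 d;
   polarizing the last one gives 18 d, hence 6 d and 3 d^2. If Frobenius is onto
   mod 2 and mod 3, then T contains 3 x and 2 x, hence x. The case n > 2 reduces
   to 2x2 blocks. Conversely tr (M^p) = (tr M)^p mod p makes the trace of a sum of
   sixth powers a p-th power mod p, so Frobenius must be onto.

   Frobenius is onto, equivalently one-to-one, on the finite ring O / pO exactly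
   when the trace form of O is nondegenerate mod p. *)
Require Import Defs.
From HB Require Import structures.
From mathcomp Require Import all_boot all_order all_fingroup all_algebra all_field.
From mathcomp Require Import ring zify.

Set Implicit Arguments.
Unset Strict Implicit.
Unset Printing Implicit Defensive.

Import GRing.Theory.
Import Num.Theory passmx.
Local Open Scope ring_scope.

(** * Congruence modulo p in a subring, and additivity of the p-th power for p = 2, 3 *)

Section Congruence.
Variables (R : comNzRingType) (O : subringClosed R) (p : nat).

Definition eqmod (x y : R) : Prop := exists2 z, z \in O & x = y + z *+ p.

Lemma eqmod_refl x : eqmod x x.
Proof. by exists 0; rewrite ?rpred0 // mul0rn addr0. Qed.

Lemma eqmod_sym x y : eqmod x y -> eqmod y x.
Proof. by case=> z zO ->; exists (- z); rewrite ?rpredN // mulNrn addrK. Qed.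

Lemma eqmod_trans y x z : eqmod x y -> eqmod y z -> eqmod x z.
Proof.
by case=> u uO -> [v vO ->]; exists (v + u); rewrite ?rpredD // mulrnDl addrA.
Qed.

Lemma eqmodD x y x' y' : eqmod x y -> eqmod x' y' -> eqmod (x + x') (y + y').
Proof.
case=> u uO -> [v vO ->]; exists (u + v); rewrite ?rpredD // mulrnDl.
by rewrite addrACA.
Qed.

Lemma eqmod_sum (I : Type) (r : seq I) (P : pred I) (F G : I -> R) :
  (forall i, P i -> eqmod (F i) (G i)) ->
  eqmod (\sum_(i <- r | P i) F i) (\sum_(i <- r | P i) G i).
Proof.
move=> FG; apply: (big_ind2 eqmod) => //; first exact: eqmod_refl.
by move=> x1 x2 y1 y2; exact: eqmodD.
Qed.

Lemma eqmodM x y x' y' : y \in O -> x' \in O ->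
  eqmod x y -> eqmod x' y' -> eqmod (x * x') (y * y').
Proof.
(* The witness comes from x x' - y y' = (x - y) x' + y (x' - y'). *)
move=> yO x'O [u uO ->] [v vO e]; exists (u * x' + y * v).
  by rewrite rpredD ?rpredM.
by rewrite mulrDl {1}e mulrDr mulrnDl mulrnAl mulrnAr [in LHS]addrAC addrA.
Qed.

Lemma eqmodX k x y : x \in O -> y \in O -> eqmod x y -> eqmod (x ^+ k) (y ^+ k).
Proof.
move=> xO yO xy; elim: k => [|k IHk]; first exact: eqmod_refl.
by rewrite !exprS; apply: eqmodM; rewrite ?rpredX.
Qed.

Hypothesis p23 : p \in [:: 2; 3].

Lemma eqmod_FrobeniusD x y : x \in O -> y \in O ->
  eqmod ((x + y) ^+ p) (x ^+ p + y ^+ p).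
Proof.
move=> xO yO; move: p23; rewrite /eqmod !inE => /orP[] /eqP->.
  by exists (x * y); [rewrite rpredM | ring].
exists (x ^+ 2 * y + x * y ^+ 2); last by ring.
by rewrite rpredD ?rpredM ?rpredX.
Qed.

Lemma eqmod_FrobeniusN x : x \in O -> eqmod ((- x) ^+ p) (- x ^+ p).
Proof.
move=> xO; move: p23; rewrite /eqmod !inE => /orP[] /eqP->.
  by exists (x ^+ 2); [rewrite rpredX | ring].
by exists 0; [rewrite rpred0 | ring].
Qed.

Lemma eqmod_Frobenius_sum (I : Type) (r : seq I) (P : pred I) (F : I -> R) :
  (forall i, P i -> F i \in O) ->
  eqmod ((\sum_(i <- r | P i) F i) ^+ p) (\sum_(i <- r | P i) F i ^+ p).
Proof.
move=> FO; have p0 : (p > 0)%N by move: p23; rewrite !inE => /orP[] /eqP->.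
elim: r => [|i r IHr]; first by rewrite !big_nil expr0n gtn_eqF //; exact: eqmod_refl.
rewrite !big_cons; case: ifP => // Pi.
apply: eqmod_trans (eqmod_FrobeniusD _ _) _; rewrite ?FO ?rpred_sum //.
by apply: eqmodD IHr; exact: eqmod_refl.
Qed.

End Congruence.

(** * Cyclic sums and the trace of a p-th power *)

Lemma sum_pairs_sym (V : nmodType) (n : nat) (g : 'I_n -> 'I_n -> V) :
    (forall i j, g i j = g j i) -> (forall i, g i i = 0) ->
  \sum_i \sum_j g i j = (\sum_(i < n) \sum_(j < n | (i < j)%N) g i j) *+ 2.
Proof.
move=> gC g0; rewrite mulr2n.
rewrite [X in _ = _ + X](exchange_big_dep predT) //= -big_split /=.
apply: eq_bigr => i _; rewrite (bigID (fun j : 'I_n => (i < j)%N)) /=.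
congr (_ + _); rewrite (bigID (pred1 i)) /= [X in X + _]big1 ?add0r.
  apply: eq_big => [j | j _]; last exact: gC.
  by rewrite -leqNgt ltn_neqAle andbC -val_eqE.
by move=> j /andP[_ /eqP->].
Qed.

(* Each non-constant triple has exactly one rotation (i, j, k) with i <= j and
   i < k. *)
Lemma sum_triples_cyclic (V : nmodType) (n : nat)
    (g : 'I_n -> 'I_n -> 'I_n -> V) :
    (forall i j k, g i j k = g j k i) -> (forall i, g i i i = 0) ->
  \sum_i \sum_j \sum_k g i j k =
    (\sum_(i < n) \sum_(j < n) \sum_(k < n) g i j k *+ ((i <= j) && (i < k))%N) *+ 3.
Proof.
move=> gC g0; pose h (i j k : 'I_n) := g i j k *+ ((i <= j) && (i < k))%N.
have gh i j k : g i j k = h i j k + (h j k i + h k i j).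
  rewrite /h (gC k i j) -(gC i j k) -!mulrnDr.
  have [eij|nij] := eqVneq (i : nat) j; have [eik|nik] := eqVneq (i : nat) k.
  - by move/val_inj: eij eik => <- /val_inj <-; rewrite g0 mul0rn.
  - by rewrite -{1}[LHS]mulr1n; congr (_ *+ _); lia.
  - by rewrite -{1}[LHS]mulr1n; congr (_ *+ _); lia.
  - by rewrite -{1}[LHS]mulr1n; congr (_ *+ _); lia.
under eq_bigr do under eq_bigr do under eq_bigr do rewrite gh.
under eq_bigr do under eq_bigr do rewrite !big_split /=.
under eq_bigr do rewrite !big_split /=.
rewrite !big_split /= mulrS mulr2n; congr (_ + (_ + _)).
  by rewrite exchange_big; apply: eq_bigr => i _; rewrite exchange_big.
by under eq_bigr do rewrite exchange_big; rewrite exchange_big.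
Qed.

(** The difference of the two sides is a sum over p-tuples of indices of a term [g] that is
    invariant under rotation and zero on constant tuples. As p is prime, rotation splits the other
    tuples into orbits of size p, so the sum is p times an element of [O]. *)
Lemma mxtrace_expp (R : comNzRingType) (O : subringClosed R) (p n : nat)
    (M : 'M[R]_n) : p \in [:: 2; 3] -> M \is a mxOver O ->
  eqmod O p (\tr (M ^+ p)) ((\tr M) ^+ p).
Proof.
move=> p23 /mxOverP MO; rewrite /eqmod.
move: p23; rewrite !inE => /orP[] /eqP->.
  pose g (i j : 'I_n) := M i j * M j i - M i i * M j j.
  exists (\sum_(i < n) \sum_(j < n | (i < j)%N) g i j).
    by do 2![apply: rpred_sum => ? _]; rewrite rpredB ?rpredM.
  apply/(addIr (- (\tr M) ^+ 2)); rewrite addrAC subrr add0r -sum_pairs_sym.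
  - rewrite !expr2 /mxtrace big_distrlr -sumrB; apply: eq_bigr => i _.
    by rewrite mxE -sumrB.
  - by move=> i j; rewrite /g; ring.
  - by move=> i; rewrite /g subrr.
pose g (i j k : 'I_n) := M i j * M j k * M k i - M i i * M j j * M k k.
exists (\sum_(i < n) \sum_(j < n) \sum_(k < n) g i j k *+ ((i <= j) && (i < k))%N).
  by do 3![apply: rpred_sum => ? _]; rewrite rpredMn ?rpredB ?rpredM.
apply/(addIr (- (\tr M) ^+ 3)); rewrite addrAC subrr add0r -sum_triples_cyclic.
- have -> : (\tr M) ^+ 3 = \sum_i \sum_j \sum_k M i i * M j j * M k k.
    rewrite exprSr expr2 /mxtrace big_distrlr mulr_suml; apply: eq_bigr => i _.
    rewrite mulr_suml; apply: eq_bigr => j _.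
    by rewrite mulr_sumr.
  rewrite exprSr expr2 -sumrB; apply: eq_bigr => i _.
  rewrite mxE; under [X in X - _]eq_bigr do rewrite mxE mulr_suml.
  by rewrite exchange_big -sumrB; apply: eq_bigr => j _; rewrite -sumrB.
- by move=> i j k; rewrite /g; ring.
- by move=> i; rewrite /g subrr.
Qed.

Ltac in_subring :=
  do ?[done | apply: rpred0 | apply: rpred1 | apply: rpred_nat | apply: rpredB
      | apply: rpredD | rewrite rpredN | apply: rpredM | apply: rpredX].

(** * Closure properties of sums of sixth powers *)

Section SixthPowers.
Variables (R : comNzRingType) (O : subringClosed R).

Lemma sum6_pow n (N : 'M[R]_n) :
  N \is a mxOver O -> sum_of_sixth_powers O (N ^+ 6).
Proof. by move=> NO; exists 1%N; split=> //; exists (fun=> N); rewrite big_ord1. Qed.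

Lemma sum6D n (M N : 'M[R]_n) :
  sum_of_sixth_powers O M -> sum_of_sixth_powers O N ->
  sum_of_sixth_powers O (M + N).
Proof.
case=> r [r1 [A [AO ->]]] [s [_ [B [BO ->]]]]; exists (r + s)%N.
split; first by rewrite ltn_addr.
exists (fun i => match split i with inl j => A j | inr j => B j end); split.
  by move=> i; case: splitP.
rewrite big_split_ord /=; congr (_ + _); apply: eq_bigr => i _.
  by rewrite (unsplitK (inl i)).
by rewrite (unsplitK (inr i)).
Qed.

Lemma sum60 n : sum_of_sixth_powers O (0 : 'M[R]_n).
Proof.
rewrite (_ : 0 = 0 ^+ 6); last by rewrite expr0n.
by apply: sum6_pow; rewrite mxOver0 ?rpred0.
Qed.

Lemma sum6_sum n (I : Type) (r : seq I) (P : pred I) (F : I -> 'M[R]_n) :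
  (forall i, P i -> sum_of_sixth_powers O (F i)) ->
  sum_of_sixth_powers O (\sum_(i <- r | P i) F i).
Proof. by move=> FS; apply: big_ind => //; [exact: sum60 | exact: sum6D]. Qed.

(** Since [Q *m P = 1%:M], the map taking M to P M Q is multiplicative. It serves both for
    conjugation and for placing a 2x2 matrix inside a larger one. *)
Lemma sum6_compress m n (P : 'M[R]_(m, n)) (Q : 'M_(n, m)) (M : 'M_n) :
    P \is a mxOver O -> Q \is a mxOver O -> Q *m P = 1%:M ->
  sum_of_sixth_powers O M -> sum_of_sixth_powers O (P *m M *m Q).
Proof.
move=> PO QO QP [r [r1 [N [NO ->]]]].
rewrite mulmx_sumr mulmx_suml; apply: sum6_sum => i _.
have -> : P *m N i ^+ 6 *m Q = (P *m N i *m Q) ^+ 6.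
  (* The identity can fail for exponent 0, as [P *m Q] need not be 1; generalizing 5 starts the
     induction at exponent 1. *)
  elim: 5%N => [|k IHk] //.
  rewrite exprS [RHS]exprS -IHk -!mulmxE !mulmxA; congr (_ *m _ *m _).
  by rewrite -[in RHS](mulmxA _ Q) QP mulmx1.
by apply: sum6_pow; rewrite !mxOverM.
Qed.

(** * 2x2 matrices: every trace zero matrix is a sum of sixth powers *)

Definition mx2 (a b c d : R) : 'M[R]_2 :=
  \matrix_(i, j) if i == 0 then if j == 0 then a else b
                 else if j == 0 then c else d.

Lemma mx2_eta (M : 'M[R]_2) : M = mx2 (M 0 0) (M 0 1) (M 1 0) (M 1 1).
Proof.
apply/matrixP => i j; rewrite mxE.
by case: i j => [[|[|//]] ?] [[|[|//]] ?] /=; congr (M _ _); apply: val_inj.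
Qed.

Lemma mx2D a b c d a' b' c' d' :
  mx2 a b c d + mx2 a' b' c' d' = mx2 (a + a') (b + b') (c + c') (d + d').
Proof. by apply/matrixP => i j; rewrite !mxE; do 2!case: ifP => _. Qed.

Lemma mx2M a b c d a' b' c' d' :
  mx2 a b c d *m mx2 a' b' c' d' =
  mx2 (a * a' + b * c') (a * b' + b * d') (c * a' + d * c') (c * b' + d * d').
Proof.
apply/matrixP => i j; rewrite !mxE !big_ord_recl big_ord0 addr0 !mxE /=.
by do 2!case: ifP => _.
Qed.

Lemma mx2_1 : mx2 1 0 0 1 = 1%:M.
Proof.
by apply/matrixP => -[[|[|//]] ?] [[|[|//]] ?]; rewrite !mxE.
Qed.

(** By Cayley-Hamilton M^2 = t M - e, with t the trace and e the determinant; u X + v is the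
    remainder of X^6 modulo X^2 - t X + e. *)
Lemma mx2_exp6 a b c d (t := a + d) (e := a * d - b * c)
    (u := t ^+ 5 - 4%:R * t ^+ 3 * e + 3%:R * t * e ^+ 2)
    (v := - e * (t ^+ 4 - 3%:R * t ^+ 2 * e + e ^+ 2)) :
  mx2 a b c d ^+ 6 = mx2 (u * a + v) (u * b) (u * c) (u * d + v).
Proof.
rewrite !exprS expr0 mulr1 -!mulmxE !mx2M /u /v /t /e.
by congr mx2; ring.
Qed.

Lemma mx2_over a b c d : a \in O -> b \in O -> c \in O -> d \in O ->
  mx2 a b c d \is a mxOver O.
Proof.
by move=> *; apply/mxOverP => i j; rewrite mxE; do 2!case: ifP => _.
Qed.

Lemma sum6_E01 b : b \in O -> sum_of_sixth_powers O (mx2 0 b 0 0).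
Proof.
(* The first two matrices are idempotents with sum [mx2 1 b 0 1]; the third has square -1, so its
   sixth power removes the identity. *)
move=> bO; suff -> : mx2 0 b 0 0 =
    mx2 1 b 0 0 ^+ 6 + mx2 0 0 0 1 ^+ 6 + mx2 0 (-1) 1 0 ^+ 6.
  by do ![apply: sum6D]; apply/sum6_pow/mx2_over; rewrite ?rpredN ?rpred0 ?rpred1.
by rewrite !mx2_exp6 !mx2D; congr mx2; ring.
Qed.

Lemma sum6_conj (x y z w : R) (M : 'M[R]_2) : x * w - y * z = 1 ->
    x \in O -> y \in O -> z \in O -> w \in O -> sum_of_sixth_powers O M ->
  sum_of_sixth_powers O (mx2 x y z w *m M *m mx2 w (- y) (- z) x).
Proof.
move=> det1 xO yO zO wO; apply: sum6_compress; rewrite ?mx2_over ?rpredN //.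
by rewrite mx2M -mx2_1; congr mx2; rewrite -?det1; ring.
Qed.

Lemma sum6_trace0 a b c : a \in O -> b \in O -> c \in O ->
  sum_of_sixth_powers O (mx2 a b c (- a)).
Proof.
move=> aO bO cO.
have E10 x : x \in O -> sum_of_sixth_powers O (mx2 0 0 x 0).
  move=> xO; have -> : mx2 0 0 x 0 =
      mx2 0 1 (-1) 0 *m mx2 0 (- x) 0 0 *m mx2 0 (- 1) (- -1) 0.
    by rewrite !mx2M; congr mx2; ring.
  apply: sum6_conj; rewrite ?rpredN ?rpred0 ?rpred1 //; first by ring.
  by apply: sum6_E01; rewrite rpredN.
(* The conjugate equals [mx2 a a (- a) (- a)]: it supplies the diagonal, and the two nilpotent terms
   correct the remaining entries. *)
have -> : mx2 a b c (- a) = mx2 0 (b - a) 0 0 + mx2 0 0 (c + a) 0 +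
    mx2 1 0 (-1) 1 *m mx2 0 a 0 0 *m mx2 1 (- 0) (- -1) 1.
  by rewrite !mx2M !mx2D; congr mx2; ring.
do 2?apply: sum6D; first by apply: sum6_E01; rewrite rpredB.
  by apply: E10; rewrite rpredD.
apply: sum6_conj; rewrite ?rpredN ?rpred0 ?rpred1 //; first by ring.
exact: sum6_E01.
Qed.

(** Adding a trace zero matrix moves the trace into one corner. Together with the converse
    [sum6_of_diag_tr], this leaves only the trace to be studied. *)
Lemma sum6_diag_tr x y z w : y \in O -> z \in O -> w \in O ->
  sum_of_sixth_powers O (mx2 x y z w) ->
  sum_of_sixth_powers O (mx2 (x + w) 0 0 0).
Proof.
move=> yO zO wO S.
have -> : mx2 (x + w) 0 0 0 = mx2 x y z w + mx2 w (- y) (- z) (- w).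
  by rewrite mx2D; congr mx2; ring.
by apply: sum6D => //; apply: sum6_trace0; rewrite ?rpredN.
Qed.

Lemma sum6_of_diag_tr x y z w : y \in O -> z \in O -> w \in O ->
  sum_of_sixth_powers O (mx2 (x + w) 0 0 0) ->
  sum_of_sixth_powers O (mx2 x y z w).
Proof.
move=> yO zO wO S.
have -> : mx2 x y z w = mx2 (x + w) 0 0 0 + mx2 (- w) y z (- - w).
  by rewrite mx2D; congr mx2; ring.
by apply: sum6D => //; apply: sum6_trace0; rewrite ?rpredN.
Qed.

(** * The additive monoid of traces of sums of sixth powers of 2x2 matrices *)

Section Diagonal.

Local Notation T x := (sum_of_sixth_powers O (mx2 x 0 0 0)).

Lemma diag6D x y : T x -> T y -> T (x + y).
Proof.
move=> Tx Ty; suff -> : mx2 (x + y) 0 0 0 = mx2 x 0 0 0 + mx2 y 0 0 0.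
  exact: sum6D.
by rewrite mx2D !addr0.
Qed.

(* The trace of the sixth power of the companion matrix of X^2 - t X + d. *)
Lemma diag6_newton t d : t \in O -> d \in O ->
  T (t ^+ 6 - 6%:R * t ^+ 4 * d + 9%:R * t ^+ 2 * d ^+ 2 - 2%:R * d ^+ 3).
Proof.
move=> tO dO; have XO : mx2 t (- d) 1 0 \is a mxOver O.
  by rewrite mx2_over ?rpred0 ?rpred1 ?rpredN.
have := sum6_pow XO; rewrite mx2_exp6 => /sum6_diag_tr S.
refine (eq_ind _ (fun a => T a) (S _ _ _) _ _).
all: try by in_subring.
by ring.
Qed.

Lemma diag6_2cube d : d \in O -> T (2%:R * d ^+ 3).
Proof.
move=> dO; have := diag6_newton (rpred0 O) (_ : - d \in O).
by rewrite rpredN => /(_ dO); congr (T _); ring.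
Qed.

Lemma diag6_12 x : x \in O -> T (12%:R * x).
Proof.
move=> xO.
(* Twice the second difference (x + 1)^3 + (x - 1)^3 - 2 x^3 = 6 x, with the minus sign moved inside
   the cube. *)
have -> : 12%:R * x = 2%:R * (x + 1) ^+ 3 + 2%:R * (x - 1) ^+ 3 +
   (2%:R * (- x) ^+ 3 + 2%:R * (- x) ^+ 3) by ring.
by do ![apply: diag6D]; apply: diag6_2cube; rewrite ?rpredN ?rpredB ?rpredD ?rpred1.
Qed.

Lemma diag6N x : x \in O -> T x -> T (- x).
Proof.
move=> xO Tx; have -> : - x = 12%:R * - x + x *+ 11 by ring.
apply: diag6D; first by apply: diag6_12; rewrite rpredN.
by elim: 10%N => // k IHk; rewrite mulrS; apply: diag6D.
Qed.

Lemma diag6B x y : y \in O -> T x -> T y -> T (x - y).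
Proof. by move=> yO Tx Ty; apply: diag6D => //; apply: diag6N. Qed.

Lemma diag6_all x :
    (forall y, y \in O -> exists2 z, z \in O & eqmod O 2 y (z ^+ 2)) ->
    (forall y, y \in O -> exists2 z, z \in O & eqmod O 3 y (z ^+ 3)) ->
  x \in O -> T x.
Proof.
move=> frob2 frob3 xO.
have Tg d : d \in O -> T (9%:R * d ^+ 2 - 6%:R * d).
  (* At t = 1 the generator is 1 - 6 d + 9 d^2 - 2 d^3; adding 2 d^3 and then -1 leaves the
     claim. *)
  move=> dO; have := diag6D (diag6_newton (rpred1 O) dO) (diag6_2cube dO).
  have T1 : T 1 by have := diag6_newton (rpred1 O) (rpred0 O); congr (T _); ring.
  move/diag6D/(_ (diag6N (rpred1 O) T1)); congr (T _); ring.
have T6 d : d \in O -> T (6%:R * d).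
  (* With g(d) = 9 d^2 - 6 d, polarization gives g(d + 1) - g(d) - g(1) = 18 d. *)
  move=> dO; have -> : 6%:R * d = (9%:R * (d + 1) ^+ 2 - 6%:R * (d + 1))
      - ((9%:R * d ^+ 2 - 6%:R * d) + (9%:R * 1 ^+ 2 - 6%:R * 1)) - 12%:R * d.
    by ring.
  have d1 : d + 1 \in O by in_subring.
  apply: diag6B; [by in_subring | | exact: diag6_12].
  apply: diag6B; [by in_subring | exact: Tg |].
  by apply: diag6D; apply: Tg; rewrite ?rpred1.
have T3 d : d \in O -> T (3%:R * d ^+ 2).
  move=> dO; have -> : 3%:R * d ^+ 2 =
      9%:R * d ^+ 2 - 6%:R * d + 6%:R * (d - d ^+ 2) by ring.
  by apply: diag6D; [apply: Tg | apply: T6; in_subring].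
have [y yO [u uO xy]] := frob2 _ xO; have [z zO [v vO xz]] := frob3 _ xO.
(* This is x = 3 x - 2 x, with x = y^2 + 2 u in the first term and x = z^3 + 3 v in the second. *)
have -> : x = (3%:R * y ^+ 2 + 6%:R * u) - (2%:R * z ^+ 3 + 6%:R * v).
  rewrite -[LHS](_ : 3%:R * x - 2%:R * x = x); last by ring.
  by rewrite {1}xy xz; ring.
by apply: diag6B; [by in_subring | |]; apply: diag6D; auto using diag6_2cube.
Qed.

End Diagonal.

(** * Matrices of any size: reduction to 2x2 blocks, and necessity of Frobenius being onto *)

Lemma sum6_all n (M : 'M[R]_n) : (2 <= n)%N ->
    (forall x, x \in O -> exists2 y, y \in O & eqmod O 2 x (y ^+ 2)) ->
    (forall x, x \in O -> exists2 y, y \in O & eqmod O 3 x (y ^+ 3)) ->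
  M \is a mxOver O -> sum_of_sixth_powers O M.
Proof.
move=> n2 frob2 frob3 /mxOverP MO.
have E (i j : 'I_n) (N : 'M[R]_2) : i != j -> N \is a mxOver O ->
    sum_of_sixth_powers O (\sum_k \sum_l N k l *: delta_mx
      (if k == 0 then i else j) (if l == 0 then i else j)).
  move=> ij /mxOverP NO.
  (* The columns of [P] are the unit vectors at i and j, so P N P^T places N on the rows and columns
     i, j. *)
  pose P : 'M[R]_(n, 2) := \matrix_(r, k) (r == if k == 0 then i else j)%:R.
  have PO : P \is a mxOver O by apply/mxOverP => r k; rewrite mxE rpred_nat.
  have PP : P^T *m P = 1%:M.
    apply/matrixP => k l; rewrite !mxE (bigD1 (if k == 0 then i else j)) //=.
    rewrite big1 => [|r /negPf rk]; last by rewrite !mxE rk mul0r.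
    rewrite !mxE eqxx mul1r addr0; congr (_%:R); congr nat_of_bool.
    case: k l => [[|[|//]] ?] [[|[|//]] ?]; rewrite /= ?eqxx // -val_eqE /=.
      exact: negPf.
    by rewrite eq_sym; exact: negPf.
  have NS : sum_of_sixth_powers O N.
    by rewrite [N]mx2_eta; apply: sum6_of_diag_tr => //; apply: diag6_all; rewrite ?rpredD.
  have {NS} := sum6_compress PO _ PP NS; rewrite (_ : P^T \is a _) => [/(_ isT)|].
    congr sum_of_sixth_powers; apply/matrixP => r s; rewrite !mxE summxE.
    under eq_bigr do rewrite mxE mulr_suml.
    rewrite exchange_big; apply: eq_bigr => k _; rewrite summxE.
    apply: eq_bigr => l _; rewrite !mxE -mulnb natrM; ring.
  by apply/mxOverP => r k; rewrite !mxE rpred_nat.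
(* Each entry is treated alone, inside the block on its own two indices; a diagonal entry borrows a
   second index k, available because n is at least 2. *)
rewrite [M]matrix_sum_delta; apply: sum6_sum => i _; apply: sum6_sum => j _.
have Ni (c a b : R) : a \in O -> b \in O -> mx2 a b 0 0 \is a mxOver O.
  by move=> *; apply: mx2_over; rewrite ?rpred0.
have [<-|ij] := eqVneq i j.
  have [k ik] : exists k : 'I_n, i != k.
    have n0 : (0 < n)%N by apply: leq_trans n2.
    have [i0|i0] := eqVneq (i : nat) 0%N.
      by exists (Ordinal n2); rewrite -val_eqE /= i0.
    by exists (Ordinal n0).
  have := E i k (mx2 (M i i) 0 0 0) ik (Ni 0 _ _ (MO _ _) (rpred0 O)).
  by rewrite !big_ord_recl !big_ord0 !mxE /= !scale0r !addr0.
have := E i j (mx2 0 (M i j) 0 0) ij (Ni 0 _ _ (rpred0 O) (MO _ _)).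
by rewrite !big_ord_recl !big_ord0 !mxE /= !scale0r !addr0 !add0r.
Qed.

(** Take a matrix of trace x and write it as a sum of sixth powers. Each N^6 is the p-th power of
    N^(6/p), so modulo p the trace x is a sum of p-th powers of traces, hence a p-th power. *)
Lemma sum6_Frobenius_surj p n x : p \in [:: 2; 3] -> (0 < n)%N ->
    (forall M : 'M[R]_n, M \is a mxOver O -> sum_of_sixth_powers O M) ->
  x \in O -> exists2 y, y \in O & eqmod O p x (y ^+ p).
Proof.
move=> p23 n0 S xO.
have p6 : (6 = 6 %/ p * p)%N by move: p23; rewrite !inE => /orP[] /eqP->.
pose i0 := Ordinal n0.
have /S[r [_ [N [NO e]]]] : x *: delta_mx i0 i0 \is a @mxOver n n _ O.
  by apply/mxOverP => i j; rewrite !mxE rpredM ?rpred_nat.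
have NXO i k : N i ^+ k \is a mxOver O.
  elim: k => [|k IHk]; first by rewrite expr0 mxOver_scalar ?rpred0 ?rpred1.
  by rewrite exprS -mulmxE mxOverM.
have trO i : \tr (N i ^+ (6 %/ p)) \in O.
  by apply: rpred_sum => j _; exact: (mxOverP (NXO i (6 %/ p)%N)).
exists (\sum_i \tr (N i ^+ (6 %/ p))); first exact: rpred_sum.
have -> : x = \sum_i \tr ((N i ^+ (6 %/ p)) ^+ p).
  have /(congr1 mxtrace) := e; rewrite mxtraceZ raddf_sum /=.
  under eq_bigr do rewrite p6 exprM.
  move=> <-; rewrite /mxtrace (bigD1 i0) //= mxE !eqxx big1 ?addr0 ?mulr1 //.
  by move=> j /negPf ji; rewrite mxE ji.
apply: eqmod_trans; last by apply: eqmod_sym; apply: eqmod_Frobenius_sum.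
by apply: eqmod_sum => i _; apply: mxtrace_expp.
Qed.

End SixthPowers.

(** * Traces of integer matrices modulo p, and diagonalizability over a finite field *)

Lemma prime23 p : p \in [:: 2; 3] -> prime p.
Proof. by rewrite !inE => /orP[] /eqP->. Qed.

Lemma dvdz_primeX (p k : nat) (a : int) :
  prime p -> (p %| a ^+ k)%Z -> (p %| a)%Z.
Proof. by move=> pp; rewrite !dvdzE abszX Euclid_dvdX // => /andP[]. Qed.

Lemma dvdz_mulrn (p : nat) (a : int) : (p %| a *+ p)%Z.
Proof. by rewrite -mulr_natr natz dvdz_mull. Qed.

(** Used to show that an integer matrix whose p-th power vanishes mod p has trace divisible by p. *)
Lemma mxtrace_expp_int (p n : nat) (M : 'M[int]_n) : p \in [:: 2; 3] ->
  (p %| \tr (M ^+ p))%Z -> (p %| \tr M)%Z.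
Proof.
move=> p23; have ZT : subring_closed (predT : {pred int}) by [].
pose Z : subringClosed int :=
  HB.pack (predT : int -> bool) (GRing.isSubringClosed.Build int predT ZT).
have MZ : M \is a mxOver Z by apply/mxOverP.
have [z _ ->] := mxtrace_expp p23 MZ.
rewrite rpredDr ?dvdz_mulrn //.
exact/dvdz_primeX/prime23.
Qed.

Lemma map_intr_inj k l : injective (map_mx intr : 'M[int]_(k, l) -> 'M[rat]_(k, l)).
Proof.
move=> A B /matrixP AB; apply/matrixP => i j; apply: (@intr_inj rat).
by have := AB i j; rewrite !mxE.
Qed.

(** With q the order of F, X^q - X is the product of all X - a for a in F. It annihilates A, so the
    minimal polynomial splits with simple roots. *)
Lemma diagonalizable_expf_card (F : finFieldType) n (A : 'M[F]_n) :
  A ^+ #|F| = A -> diagonalizable A.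
Proof.
case: n A => [|n] A AF; first by rewrite thinmx0; exact: diagonalizable0.
apply/diagonalizableP; exists (enum F); first exact: enum_uniq.
apply: mxminpoly_min; rewrite big_enum -finField_genPoly.
by rewrite rmorphB rmorphXn /= horner_mx_X AF subrr.
Qed.

(** * Integral coordinates, the regular representation and the Gram matrix of the trace form *)

Section RegularRepresentation.
Variables (K : fieldExtType rat) (O : subringClosed K).
Local Notation m := (\dim {:K}).
Variable b : m.-tuple K.
Hypothesis bO : Zbasis O b.

Let bB : basis_of {:K} b := Zbasis_basis bO.
Let bf : free b := basis_free bB.
Let bmem i : b`_i \in O.
Proof.
case: (ltnP i m) => im; first exact: (Zbasis_mem (Ordinal im) bO).
by rewrite nth_default ?rpred0 // size_tuple.
Qed.

(** On [O] the rational coordinates are integers, equal to their numerators; elsewhere the numerator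
    is a default value. *)
Definition icoord (i : 'I_m) (x : K) : int := numq (coord b i x).

Lemma icoordE i x : x \in O -> (icoord i x)%:~R = coord b i x.
Proof. by move=> xO; rewrite numqK //; exact: Zbasis_coord bO xO. Qed.

Lemma icoord_sum x : x \in O -> x = \sum_(i < m) b`_i *~ icoord i x.
Proof.
move=> xO; rewrite {1}(coord_basis bB (memvf x)); apply: eq_bigr => i _.
by rewrite -scaler_int icoordE.
Qed.

Lemma icoord_sumK (c : 'I_m -> int) i : icoord i (\sum_(j < m) b`_j *~ c j) = c i.
Proof.
rewrite /icoord; under eq_bigr do rewrite -scaler_int.
by rewrite coord_sum_free // numq_int.
Qed.

Lemma icoord_sum_mem (c : 'I_m -> int) : \sum_(j < m) b`_j *~ c j \in O.
Proof. by apply: rpred_sum => j _; rewrite rpredMz. Qed.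

Lemma icoordD i x y : x \in O -> y \in O ->
  icoord i (x + y) = icoord i x + icoord i y.
Proof.
move=> xO yO; apply: (@intr_inj rat).
by rewrite intrD !icoordE ?rpredD // linearD.
Qed.

Lemma icoordMn i x k : x \in O -> icoord i (x *+ k) = icoord i x *+ k.
Proof.
by move=> xO; apply: (@intr_inj rat); rewrite rmorphMn /= !icoordE ?rpredMn // linearMn.
Qed.

(** Multiplication by x acting on row vectors; integer entries allow reduction to any field of
    characteristic p. *)
Definition regmx (x : K) : 'M[int]_m := \matrix_(i, j) icoord j (b`_i * x).

Lemma map_regmx x : x \in O -> map_mx intr (regmx x) = mxof b b (amull x).
Proof.
move=> xO; apply/matrixP => i j.
by rewrite !mxE icoordE ?rpredM // vecof_delta lfunE /= mulrC.
Qed.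

Lemma mxtrace_regmx x : x \in O -> (\tr (regmx x))%:~R = fieldTrace x.
Proof.
by move=> xO; rewrite (fieldTraceE _ bB) -map_regmx // trace_map_mx.
Qed.

Lemma regmxM x y : x \in O -> y \in O -> regmx (x * y) = regmx x *m regmx y.
Proof.
move=> xO yO; apply: map_intr_inj.
rewrite map_mxM !map_regmx ?rpredM // -mxof_comp //; congr (mxof _ _ _).
by apply/lfunP => u; rewrite !lfunE /= !lfunE /= mulrCA mulrA.
Qed.

(** For x = 1 this reads the coordinates of y off [regmx y], which makes the representation faithful
    also modulo p. *)
Lemma mul_icoord_regmx x y : x \in O -> y \in O ->
  (\row_i icoord i x) *m regmx y = \row_i icoord i (x * y).
Proof.
move=> xO yO; apply/rowP => k; rewrite !mxE; apply: (@intr_inj rat).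
rewrite icoordE ?rpredM // {2}(coord_basis bB (memvf x)) mulr_suml linear_sum.
rewrite rmorph_sum /=; apply: eq_bigr => i _.
by rewrite !mxE intrM !icoordE ?rpredM // -scalerAl linearZ.
Qed.

Lemma icoord_basis (i j : 'I_m) : icoord j b`_i = (i == j)%:R.
Proof.
by rewrite /icoord coord_free //; case: eqP => _; rewrite (numq_int 1, numq_int 0).
Qed.

Lemma regmx1 : regmx 1 = 1%:M.
Proof.
by apply/matrixP => i j; rewrite !mxE mulr1 icoord_basis.
Qed.

Lemma regmxX x k : x \in O -> regmx (x ^+ k) = regmx x ^+ k.
Proof.
move=> xO; elim: k => [|k IHk]; first exact: regmx1.
by rewrite !exprS regmxM ?rpredX // IHk.
Qed.

Lemma regmxD x y : x \in O -> y \in O -> regmx (x + y) = regmx x + regmx y.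
Proof.
by move=> xO yO; apply/matrixP => i j; rewrite !mxE mulrDr icoordD ?rpredM.
Qed.

Lemma regmxMn x k : x \in O -> regmx (x *+ k) = regmx x *+ k.
Proof.
by move=> xO; apply/matrixP => i j; rewrite mulmxnE !mxE mulrnAr icoordMn ?rpredM.
Qed.

Definition gram : 'M[int]_m := \matrix_(i, j) \tr (regmx (b`_i * b`_j)).

Lemma det_gram : is_order O -> \det gram = order_disc O.
Proof.
move=> Oo; apply: (@intr_inj rat); rewrite (order_discE Oo bO) -det_map_mx.
by congr (\det _); apply/matrixP => i j; rewrite !mxE /= mxtrace_regmx ?rpredM.
Qed.

(** * Frobenius on O / pO and the trace form modulo p *)

Variable p : nat.
Hypothesis p23 : p \in [:: 2; 3].

Lemma eqmod0P x : x \in O ->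
  (forall i, (p %| icoord i x)%Z) -> eqmod O p x 0.
Proof.
move=> xO px; exists (\sum_(i < m) b`_i *~ (icoord i x %/ p)%Z).
  exact: icoord_sum_mem.
rewrite add0r -sumrMnl {1}(icoord_sum xO); apply: eq_bigr => i _.
by rewrite -{1}(divzK (px i)) mulrzA pmulrn.
Qed.

(* If x^p = 0 mod p, then every x y with y in O is nilpotent mod p, so x lies
   in the radical of the trace form mod p. *)
Lemma disc_Frobenius_inj x : ~~ (p %| \det gram)%Z -> x \in O ->
  eqmod O p (x ^+ p) 0 -> eqmod O p x 0.
Proof.
move=> pD xO [z zO]; rewrite add0r => xp; apply: eqmod0P => // i.
have pp := prime23 p23.
have tr0 y : y \in O -> (p %| \tr (regmx (x * y)))%Z.
  move=> yO; apply: mxtrace_expp_int => //.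
  rewrite -regmxX ?rpredM // exprMn xp mulrnAl regmxMn ?rpredM ?rpredX //.
  by rewrite raddfMn dvdz_mulrn.
pose c : 'rV[int]_m := \row_j icoord j x.
have cG j : (p %| ((c *m gram) 0 j)%R)%Z.
  suff -> : (c *m gram) 0 j = \tr (regmx (x * b`_j)) by exact: tr0.
  apply: (@intr_inj rat); rewrite mxtrace_regmx ?rpredM //.
  rewrite (icoord_sum xO) mulr_suml mxE rmorph_sum /=.
  under [in RHS]eq_bigr do rewrite -scaler_int -scalerAl.
  rewrite fieldTrace_sum; apply: eq_bigr => k _.
  by rewrite !mxE intrM mxtrace_regmx ?rpredM.
(* The adjugate turns [c *m gram] into [\det gram] times [c], and [\det gram] is prime to p. *)
have : (p %| ((c *m gram *m \adj gram) 0 i)%R)%Z.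
  by rewrite mxE; apply: rpred_sum => k _; rewrite dvdz_mulr.
rewrite -mulmxA mul_mx_adj mul_mx_scalar !mxE Gauss_dvdzr //.
by rewrite /coprimez -[gcdz _ _]/((gcdn _ _)%:Z) eqz_nat [_ == _]prime_coprime.
Qed.

Lemma charFp : p \in [pchar 'F_p].
Proof. by rewrite pchar_Fp ?prime23. Qed.

(** Coordinates mod p identify O / pO with a finite type, on which injective and surjective
    self-maps coincide. *)
Definition redp (x : K) : 'rV['F_p]_m := \row_i (icoord i x)%:~R.

Definition liftp (c : 'rV['F_p]_m) : K := \sum_(i < m) b`_i *~ (c 0 i : nat).

Lemma liftp_mem c : liftp c \in O.
Proof. exact: (icoord_sum_mem (fun i => (c 0 i : nat) : int)). Qed.

Lemma liftpK c : redp (liftp c) = c.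
Proof.
apply/rowP => i; rewrite mxE (icoord_sumK (fun i => (c 0 i : nat) : int)).
by rewrite -pmulrn natr_Zp.
Qed.

Lemma redpP x y : x \in O -> y \in O -> eqmod O p x y <-> redp x = redp y.
Proof.
move=> xO yO; split=> [[z zO ->] | /rowP xy].
  apply/rowP => i; rewrite !mxE icoordD ?rpredMn // icoordMn //.
  by rewrite rmorphD rmorphMn /= -mulr_natr (pcharf0 charFp) mulr0 addr0.
have : eqmod O p (x - y) 0.
  apply: eqmod0P => [|i]; first by rewrite rpredB.
  rewrite (dvdz_pcharf charFp) icoordD ?rpredN //.
  have -> : icoord i (- y) = - icoord i y.
    by apply: (@intr_inj rat); rewrite rmorphN /= !icoordE ?rpredN // linearN.
  by have := xy i; rewrite !mxE rmorphB /= => ->; rewrite subrr.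
by case=> z zO e; exists z; rewrite // -[x](subrK y) e add0r addrC.
Qed.

Lemma redpK x : x \in O -> eqmod O p (liftp (redp x)) x.
Proof. by move=> xO; apply/redpP; rewrite ?liftp_mem // liftpK. Qed.

Definition Frobp (c : 'rV['F_p]_m) : 'rV['F_p]_m := redp (liftp c ^+ p).

Lemma Frobp_red x : x \in O -> Frobp (redp x) = redp (x ^+ p).
Proof.
move=> xO; apply/redpP; rewrite ?rpredX ?liftp_mem //.
by apply: eqmodX; rewrite ?liftp_mem //; exact: redpK.
Qed.

Lemma iter_Frobp_red k x : x \in O -> iter k Frobp (redp x) = redp (x ^+ (p ^ k)).
Proof.
move=> xO; elim: k => [|k IHk]; first by rewrite expr1.
by rewrite iterS IHk Frobp_red ?rpredX // -exprM -expnSr.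
Qed.

(** Additivity modulo p turns a trivial kernel into injectivity, and an injective self-map of a
    finite set is onto. *)
Lemma Frobenius_inj_surj :
    (forall x, x \in O -> eqmod O p (x ^+ p) 0 -> eqmod O p x 0) ->
  forall x, x \in O -> exists2 y, y \in O & eqmod O p x (y ^+ p).
Proof.
move=> inj x xO; have Finj : injective Frobp.
  move=> c d /redpP; rewrite ?rpredX ?liftp_mem // => /(_ isT isT) e.
  rewrite -[c]liftpK -[d]liftpK; apply/redpP; rewrite ?liftp_mem //.
  have cdO : liftp c - liftp d \in O by rewrite rpredB ?liftp_mem.
  have [|z zO] := inj _ cdO; last first.
    by move=> e'; exists z; rewrite // -[LHS](subrK (liftp d)) e' add0r addrC.
  apply: eqmod_trans (eqmod_FrobeniusD p23 (liftp_mem c) _) _.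
    by rewrite rpredN liftp_mem.
  rewrite -(subrr (liftp d ^+ p)); apply: eqmodD => //.
  by apply: eqmod_FrobeniusN; rewrite ?liftp_mem.
have /codomP[c cx] := injF_onto Finj (redp x).
exists (liftp c); first exact: liftp_mem.
by apply/redpP; rewrite ?rpredX ?liftp_mem.
Qed.

(** A surjective self-map of a finite set is a permutation; k is its order. *)
Lemma Frobenius_surj_periodic :
    (forall x, x \in O -> exists2 y, y \in O & eqmod O p x (y ^+ p)) ->
  exists2 k, (0 < k)%N & forall x, x \in O -> eqmod O p (x ^+ (p ^ k)) x.
Proof.
move=> surj.
have Fsurj c : c \in codom Frobp.
  have [y yO cy] := surj _ (liftp_mem c); apply/codomP; exists (redp y).
  by rewrite Frobp_red // -[LHS]liftpK; apply/redpP; rewrite ?liftp_mem ?rpredX.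
have Finj : injective Frobp.
  apply/injectiveP; rewrite /dinjectiveb; apply/card_uniqP.
  by rewrite size_codom; apply: eq_card => c; rewrite Fsurj.
exists #[perm Finj]%g => [|x xO]; first exact: order_gt0.
apply/redpP; rewrite ?rpredX // -iter_Frobp_red //.
by rewrite -(eq_iter (permE Finj)) -permX expg_order perm1.
Qed.

(* Over the field with p^k elements, the regular representation mod p is
   simultaneously diagonalizable, so the Gram matrix is V V^T where the i-th row
   of V is the spectrum of b_i. A linear relation between the rows of V is one
   between the b_i mod p. *)
Lemma Frobenius_surj_disc :
    (forall x, x \in O -> exists2 y, y \in O & eqmod O p x (y ^+ p)) ->
  ~~ (p %| \det gram)%Z.
Proof.
move=> /Frobenius_surj_periodic[k k0 per].
(* The size p^k of L turns the congruence x^(p^k) = x into [rho x ^+ #|L| = rho x], the condition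
   for diagonalizability over L. *)
have [L charL cardL] := pPrimePowerField (prime23 p23) k0.
pose rho x : 'M[L]_m := map_mx intr (regmx x).
have rhoM x y : x \in O -> y \in O -> rho (x * y) = rho x *m rho y.
  by move=> xO yO; rewrite /rho regmxM // map_mxM.
have rho_card x : x \in O -> rho x ^+ #|L| = rho x.
  move=> xO; have -> j : rho x ^+ j = rho (x ^+ j).
    elim: j => [|j IHj]; first by rewrite /rho regmx1 map_mx1.
    by rewrite !exprS IHj rhoM ?rpredX.
  have [z zO e] := per x xO; rewrite cardL e /rho regmxD ?rpredMn // regmxMn //.
  apply/matrixP => i j; rewrite !(mulmxnE, mxE) rmorphD rmorphMn /=.
  by rewrite -mulr_natr (pcharf0 charL) mulr0 addr0.
pose As := [seq rho b`_i | i : 'I_m].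
have [P Punit /allP diagP] : codiagonalizable As.
  apply/codiagonalizableP; split=> [_ _ /mapP[i _ ->] /mapP[j _ ->]|_ /mapP[i _ ->]].
    by rewrite /comm_mx -!rhoM // mulrC.
  by apply: diagonalizable_expf_card; rewrite rho_card.
have /fin_all_exists[d dP] (i : 'I_m) :
    exists d : 'rV_m, P *m rho b`_i = diag_mx d *m P.
  have /diagP/= : rho b`_i \in As by apply: map_f; rewrite mem_enum.
  by case/similar_diagPex => d /(similarP Punit) e; exists d.
have rhoE (i : 'I_m) : rho b`_i = invmx P *m diag_mx (d i) *m P.
  by rewrite -mulmxA -dP mulKmx.
pose V : 'M[L]_m := \matrix_(i, j) d i 0 j.
have gramE : map_mx intr gram = V *m V^T.
  apply/matrixP => i j; rewrite !mxE -trace_map_mx -/(rho _) rhoM // !rhoE.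
  rewrite -!mulmxA (mulKVmx Punit) mxtrace_mulC -!mulmxA (mulmxV Punit) mulmx1.
  by rewrite mulmx_diag mxtrace_diag; apply: eq_bigr => l _; rewrite !mxE.
rewrite (dvdz_pcharf charL) -det_map_mx gramE det_mulmx det_tr mulf_eq0 orbb.
apply/det0P => -[c /negP c0 cV]; apply: c0; apply/eqP.
have c_rho : \sum_i c 0 i *: rho b`_i = 0.
  transitivity (invmx P *m (\sum_i c 0 i *: diag_mx (d i)) *m P).
    rewrite mulmx_sumr mulmx_suml; apply: eq_bigr => i _.
    by rewrite rhoE -scalemxAr -scalemxAl.
  suff -> : \sum_i c 0 i *: diag_mx (d i) = 0 by rewrite mulmx0 mul0mx.
  under eq_bigr do rewrite -linearZ.
  rewrite -linear_sum; suff -> : \sum_i c 0 i *: d i = c *m V by rewrite cV linear0.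
  by apply/rowP => j; rewrite summxE !mxE; apply: eq_bigr => i _; rewrite !mxE.
(* The coordinate row of 1 times [rho b_i] is the i-th unit vector, so applying it to the relation
   [c_rho] returns [c] itself. *)
have u_rho (i : 'I_m) :
    map_mx intr (\row_j icoord j 1) *m rho b`_i = delta_mx 0 i.
  rewrite -map_mxM mul_icoord_regmx ?rpred1 // mul1r.
  by apply/rowP => j; rewrite !mxE icoord_basis eq_sym eqxx; case: eqP.
have := congr1 (mulmx (map_mx intr (\row_j icoord j 1))) c_rho.
rewrite mulmx0 mulmx_sumr => <-; rewrite {1}[c]row_sum_delta.
apply: eq_bigr => i _.
by rewrite -scalemxAr u_rho.
Qed.

End RegularRepresentation.

(** * Assembly of the equivalence from the cases p = 2 and p = 3 *)

Lemma gcdz6_eq1 (d : int) :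
  gcdz 6 d = 1 <-> (forall p : nat, p \in [:: 2; 3] -> ~~ (p %| d)%Z).
Proof.
have -> : gcdz 6 d = 1 <-> coprime (2 * 3) `|d|.
  by split=> [[] /eqP | /eqP e]; rewrite // /gcdz e.
rewrite coprimeMl !prime_coprime //; split=> [/andP[d2 d3] p|d23].
  by rewrite !inE dvdzE => /orP[] /eqP->.
by have := d23 2%N isT; have := d23 3%N isT; rewrite !dvdzE /= => -> ->.
Qed.

Theorem theorem5p2 (K : fieldExtType rat) (O : {pred K}) (n : nat)
  (hO : is_order O) (hn : (2 <= n)%N) :
  (forall M : 'M[K]_n, M \is a mxOver O -> sum_of_sixth_powers O M)
  <-> gcdz 6 (order_disc O) = 1.
Proof.
have [Oring [b bO]] := hO.
pose S : subringClosed K :=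
  HB.pack (O : K -> bool) (GRing.isSubringClosed.Build K O Oring).
have disc : \det (gram b) = order_disc O := @det_gram K S b bO hO.
split=> [sum6 | /gcdz6_eq1 disc23 M MO].
  apply/gcdz6_eq1 => p p23; rewrite -disc.
  apply: (@Frobenius_surj_disc K S b bO p p23) => x.
  exact: (@sum6_Frobenius_surj K S p n x p23 (ltnW hn) sum6).
have frob p : p \in [:: 2; 3] ->
    forall x, x \in S -> exists2 y, y \in S & eqmod S p x (y ^+ p).
  move=> p23; apply: (@Frobenius_inj_surj K S b bO p p23) => x xS.
  by apply: (@disc_Frobenius_inj K S b bO p p23) => //; rewrite disc disc23.
exact: (@sum6_all K S n M hn (frob 2%N isT) (frob 3%N isT) MO).
Qed.
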